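(* Let $D\geq 1$ be an integer and let $A$ be the free $\mathbb{P}_\nearrow$-algebra generated by $D$ elements. Then $H_0^\nearrow(A)$ is $D$-dimensional, and $H_n^\nearrow(A)=(0)$ for all $n\geq 1$.
   Context: Vector spaces are over a field $K$. A $\mathbb{P}_\nearrow$-algebra is a $K$-vector space $A$ (no unit is assumed) with two bilinear products, $(a,b)\mapsto ab$ (the product $m$) and $(a,b)\mapsto a\nearrow b$, satisfying for all $a,b,c\in A$: $$(a\nearrow b)\nearrow c=a\nearrow(b\nearrow c),\qquad a\nearrow(bc)=(a\nearrow b)c,\qquad (ab)c=a(bc).$$ Homology of a $\mathbb{P}_\nearrow$-algebra $A$. For $n\geq1$ let $T_\nearrow(A)(n)=\bigoplus_{k=1}^n A^{\otimes n}$; to distinguish the copies, an element of the $k$-th copy of $A^{\otimes n}$ is written with the first $k-1$ tensor signs replaced by a marked tensor sign $\otimes_{\nearrow}$ and the remaining $n-k$ signs ordinary: $v_1\otimes_{\nearrow}\cdots\otimes_{\nearrow}v_k\otimes v_{k+1}\otimes\cdots\otimes v_n$ (the mark is only a label; all tensor products are over $K$). Let $T_\nearrow(A)=\bigoplus_{n\geq1}T_\nearrow(A)(n)$. The differential $d:T_\nearrow(A)(n)\to T_\nearrow(A)(n-1)$ (with $d=0$ on $T_\nearrow(A)(1)$) is the linear map $$d(v_1\otimes_{\nearrow}\cdots\otimes_{\nearrow}v_k\otimes\cdots\otimes v_n)=\sum_{i=1}^{k-1}(-1)^{i-1}\,v_1\otimes_{\nearrow}\cdots\otimes_{\nearrow}v_{i-1}\otimes_{\nearrow}(v_i\nearrow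 v_{i+1})\otimes_{\nearrow}v_{i+2}\otimes_{\nearrow}\cdots\otimes_{\nearrow}v_k\otimes\cdots\otimes v_n$$ $$+\sum_{i=k}^{n-1}(-1)^{i-1}\,v_1\otimes_{\nearrow}\cdots\otimes_{\nearrow}v_k\otimes\cdots\otimes v_{i-1}\otimes v_iv_{i+1}\otimes v_{i+2}\otimes\cdots\otimes v_n,$$ i.e. each tensor sign in turn is contracted, using $\nearrow$ for a marked sign and $m$ for an ordinary sign, the other signs being unchanged. One has $d^2=0$. For $n\in\mathbb{N}=\{0,1,2,\ldots\}$, $$H_n^\nearrow(A)=\frac{\mathrm{Ker}\left(d_{\mid T_\nearrow(A)(n+1)}\right)}{\mathrm{Im}\left(d_{\mid T_\nearrow(A)(n+2)}\right)}.$$ *)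

(* Defs.v *)
From HB Require Import structures.
From mathcomp Require Import all_boot all_order all_algebra.
From mathcomp Require Import generic_quotient ring_quotient.
From mathcomp Require Import boolp zify.
From mathcomp.multinomials Require Import freeg.

Set Implicit Arguments.
Unset Strict Implicit.
Unset Printing Implicit Defensive.

Import GRing.Theory.
Local Open Scope ring_scope.
Local Open Scope quotient_scope.

(* The two products: [pmul a b] is the product $ab$ and [parr a b] is
   $a \nearrow b$. *)
HB.mixin Record Lmodule_isPArrowAlgebra (K : fieldType) A
    of GRing.Lmodule K A := {
  pmul : A -> A -> A;
  parr : A -> A -> A;
  pmul_linear_l : forall b, linear (pmul^~ b);
  pmul_linear_r : forall a, linear (pmul a);
  parr_linear_l : forall b, linear (parr^~ b);
  parr_linear_r : forall a, linear (parr a);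
  parrA : forall a b c, parr (parr a b) c = parr a (parr b c);
  parr_mulA : forall a b c, parr a (pmul b c) = pmul (parr a b) c;
  pmulA : forall a b c, pmul (pmul a b) c = pmul a (pmul b c)
}.

#[short(type="parrowAlgType")]
HB.structure Definition PArrowAlgebra (K : fieldType) :=
  {A of Lmodule_isPArrowAlgebra K A & GRing.Lmodule K A}.

Definition parrow_morphism (K : fieldType) (A B : parrowAlgType K)
    (f : A -> B) : Prop :=
  [/\ linear f,
      forall a b, f (pmul a b) = pmul (f a) (f b)
    & forall a b, f (parr a b) = parr (f a) (f b)].

Definition free_on (K : fieldType) (A : parrowAlgType K) (I : Type)
    (x : I -> A) : Prop :=
  forall (B : parrowAlgType K) (y : I -> B),
    exists2 f : A -> B,
      parrow_morphism f /\ (forall i, f (x i) = y i) &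
      forall g : A -> B,
        parrow_morphism g -> (forall i, g (x i) = y i) -> g =1 f.

Definition has_dim (K : fieldType) (V : lmodType K) (n : nat) : Prop :=
  exists b : 'I_n -> V,
    forall v : V, exists! c : {ffun 'I_n -> K}, v = \sum_i c i *: b i.

Section LmodQuotient.
Variables (K : fieldType) (V : lmodType K) (W : submodClosed V).

Definition submod_zmod : zmodClosed V :=
  HB.pack_for (zmodClosed V) (GRing.SubmodClosed.sort W)
    (GRing.isZmodClosed.Build V (GRing.SubmodClosed.sort W)
      (GRing.submod_closedB (submodClosedP W))).

Definition lquot := Quotient.quot submod_zmod.
HB.instance Definition _ := GRing.Zmodule.on lquot.

Definition lquot_repr (q : lquot) : V := repr q.
Definition lquot_pi (v : V) : lquot := \pi_(Quotient.quot submod_zmod) v.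
Definition lquot_scale (c : K) (q : lquot) : lquot :=
  lquot_pi (c *: lquot_repr q).

Lemma lquot_eqP (u v : V) : reflect (lquot_pi u = lquot_pi v) (u - v \in W).
Proof.
have -> : (u - v \in W) = (u - v \in submod_zmod) by [].
by rewrite Quotient.idealrBE; exact: eqP.
Qed.

Lemma lquot_reprK (q : lquot) : lquot_pi (lquot_repr q) = q.
Proof. exact: reprK. Qed.

Lemma lquot_piD u v : lquot_pi (u + v) = lquot_pi u + lquot_pi v.
Proof. by rewrite /lquot_pi raddfD. Qed.

Lemma lquot_piZ c v : lquot_pi (c *: v) = lquot_scale c (lquot_pi v).
Proof.
apply/lquot_eqP; rewrite -scalerBr rpredZ //.
by apply/lquot_eqP; rewrite lquot_reprK.
Qed.

Fact lquot_scaleA a b q :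
  lquot_scale a (lquot_scale b q) = lquot_scale (a * b) q.
Proof. by rewrite -(lquot_reprK q) -!lquot_piZ scalerA. Qed.

Fact lquot_scale1 : left_id 1 lquot_scale.
Proof. by move=> q; rewrite -(lquot_reprK q) -!lquot_piZ scale1r. Qed.

Fact lquot_scaleDr : right_distributive lquot_scale +%R.
Proof.
move=> c p q; rewrite -(lquot_reprK p) -(lquot_reprK q).
by rewrite -lquot_piD -!lquot_piZ scalerDr lquot_piD.
Qed.

Fact lquot_scaleDl q : {morph lquot_scale^~ q : a b / a + b}.
Proof.
move=> a b; rewrite -(lquot_reprK q).
by rewrite -!lquot_piZ scalerDl lquot_piD.
Qed.

HB.instance Definition _ := GRing.Zmodule_isLmodule.Build K lquot
  lquot_scaleA lquot_scale1 lquot_scaleDr lquot_scaleDl.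

Fact lquot_pi_linear : linear lquot_pi.
Proof. by move=> c u v; rewrite lquot_piD lquot_piZ. Qed.

HB.instance Definition _ :=
  GRing.isLinear.Build K V lquot *:%R lquot_pi lquot_pi_linear.

End LmodQuotient.

Section Span.
Variables (K : fieldType) (V : lmodType K) (S : V -> Prop).

Definition lspan : {pred V} := fun v =>
  `[< forall W : submodClosed V, (forall s, S s -> s \in W) -> v \in W >].

Fact lspan_submod : submod_closed lspan.
Proof.
split=> [|c u v /asboolP Wu /asboolP Wv]; apply/asboolP => W SW.
  exact: rpred0.
by rewrite rpredD ?rpredZ ?Wu ?Wv.
Qed.

HB.instance Definition _ := GRing.isSubmodClosed.Build K V lspan lspan_submod.

Lemma lspanW s : S s -> s \in lspan.
Proof. by move=> Ss; apply/asboolP => W; apply. Qed.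

End Span.

Section FreeModule.
Variables (K : fieldType) (X : choiceType) (M : lmodType K) (f : X -> M).

Fact fglift_linear : linear (fglift f : {freeg X / K} -> M).
Proof.
have fgB := lift_is_additive f.
have fg0 : fglift f 0 = 0 by rewrite -[0](subrr 0) fgB subrr.
have fgN u : fglift f (- u) = - fglift f u by rewrite -sub0r fgB fg0 sub0r.
have fgD u v : fglift f (u + v) = fglift f u + fglift f v.
  by rewrite -[v in LHS]opprK fgB fgN opprK.
have fgsum (r : seq X) (F : X -> {freeg X / K}) :
    fglift f (\sum_(x <- r) F x) = \sum_(x <- r) fglift f (F x).
  by elim: r => [|x r IH]; rewrite ?big_nil // !big_cons fgD IH.
move=> c u v; rewrite fgD; congr (_ + _).
rewrite -[in RHS](freeg_sumE u) fgsum scaler_sumr [c *: u]/(fgscale c u) fgsum.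
by apply: eq_bigr => x _; rewrite !liftU scalerA.
Qed.

End FreeModule.

(* The $n$-fold tensor power $A^{\otimes n}$, as the quotient of the vector
   space freely spanned by $A^n$ by the multilinearity relations. *)
Section TensorPower.
Variables (K : fieldType) (A : lmodType K) (n : nat).

Definition upd (v : {ffun 'I_n -> A}) (i : 'I_n) (a : A) : {ffun 'I_n -> A} :=
  [ffun j => if j == i then a else v j].

Definition multilinear (M : lmodType K) (f : {ffun 'I_n -> A} -> M) : Prop :=
  forall v i, linear (fun a => f (upd v i a)).

Definition tpow_rel (t : {freeg {ffun 'I_n -> A} / K}) : Prop :=
  exists v i c a b,
    t = << upd v i (c *: a + b) >> -
        (c *: << upd v i a >> + << upd v i b >>).

Definition tpow := lquot (lspan tpow_rel).
HB.instance Definition _ := GRing.Lmodule.on tpow.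

Definition tens (v : {ffun 'I_n -> A}) : tpow := lquot_pi _ << v >>.

Lemma tens_multilinear : multilinear tens.
Proof.
move=> v i c a b; rewrite /tens -linearP; apply/lquot_eqP/lspanW.
by exists v, i, c, a, b.
Qed.

Section Lift.
Variables (M : lmodType K) (f : {ffun 'I_n -> A} -> M) (mf : multilinear f).

(* Read off on representatives; [tlift_tens] and [tlift_linear] show that this
   is the linear map induced by [f]. *)
Definition tlift of multilinear f := fun t : tpow => fglift f (lquot_repr t).

Lemma tlift_pi u : tlift mf (lquot_pi _ u) = fglift f u.
Proof.
pose g := fglift f : {freeg {ffun 'I_n -> A} / K} -> M.
pose G : {linear _ -> M} := HB.pack g (GRing.isLinear.Build _ _ _ _ g
  (fglift_linear f)).
pose P : {pred {freeg {ffun 'I_n -> A} / K}} := fun t => G t == 0.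
have Pm : submod_closed P.
  split=> [|c a b]; rewrite !unfold_in /P ?linear0 // => /eqP a0 /eqP b0.
  by rewrite linearP a0 b0 scaler0 addr0.
pose W : submodClosed _ := HB.pack P (GRing.isSubmodClosed.Build _ _ P Pm).
apply/eqP; rewrite -subr_eq0 -[fglift f u]/(G u) /tlift -[fglift f _]/(G _).
rewrite -linearB.
have /asboolP/(_ W) : lquot_repr (lquot_pi (lspan tpow_rel) u) - u
    \in lspan tpow_rel by apply/lquot_eqP; rewrite lquot_reprK.
apply=> _ [v [i [c [a [b ->]]]]].
rewrite -[_ \in W]/(G _ == 0) linearB linearP; apply/eqP.
by rewrite -![G _]/(fglift f _) !liftU !scale1r mf subrr.
Qed.

Lemma tlift_tens v : tlift mf (tens v) = f v.
Proof. by rewrite tlift_pi liftU scale1r. Qed.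

Fact tlift_linear : linear (tlift mf).
Proof.
move=> c s t; rewrite -(lquot_reprK s) -(lquot_reprK t) -linearP /=.
by rewrite !tlift_pi fglift_linear.
Qed.

HB.instance Definition _ :=
  GRing.isLinear.Build K tpow M *:%R (tlift mf) tlift_linear.

End Lift.

End TensorPower.

Section Complex.
Variables (K : fieldType) (A : parrowAlgType K).

(* [true] stands for a marked tensor sign. *)
Definition psign (marked : bool) : A -> A -> A :=
  if marked then @parr K A else @pmul K A.

(* Entries of $v$ and tensor signs are numbered from 0, so that sign [i]
   separates entries [i] and [i + 1]. *)
Definition contract_seq n (marked : bool) (i : 'I_n)
    (v : {ffun 'I_n.+1 -> A}) : {ffun 'I_n -> A} :=
  [ffun j => let vj := v (widen_ord (leqnSn n) j) in
             let vj1 := v (fintype.lift ord0 j) in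
             if (j < i)%N then vj
             else if j == i then psign marked vj vj1 else vj1].

Fact contract_multilinear n marked (i : 'I_n) :
  multilinear (fun v => tens (contract_seq marked i v)).
Proof.
have psL b : linear ((psign marked)^~ b).
  rewrite /psign.
  by case: (marked); [exact: parr_linear_l | exact: pmul_linear_l].
have psR a : linear (psign marked a).
  rewrite /psign.
  by case: (marked); [exact: parr_linear_r | exact: pmul_linear_r].
move=> v l c a b.
have key (h : A -> A) (j : 'I_n) (w : {ffun 'I_n -> A}) : linear h ->
  (forall x, contract_seq marked i (upd v l x) = upd w j (h x)) ->
  tens (contract_seq marked i (upd v l (c *: a + b))) =
  c *: tens (contract_seq marked i (upd v l a)) +
  tens (contract_seq marked i (upd v l b)).
  by move=> hl E; rewrite !E hl tens_multilinear.
have [lti|lei] := leqP l i.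
- have ln : (l < n)%N by apply: leq_ltn_trans lti (ltn_ord i).
  pose j := Ordinal ln.
  apply: (key (fun x => if j == i
            then psign marked x (v (fintype.lift ord0 j)) else x)
           j (contract_seq marked i v)).
    by case: (j == i) => ? ? ? /=; rewrite ?psL.
  move=> x; apply/ffunP => k; rewrite !ffunE -!val_eqE /= /bump /=.
  case: (eqVneq (k : nat) l) => [kl|kl]; last first.
    case: (ltngtP k i) => // ?; case: eqP => //; lia.
  have -> : k = j by apply: val_inj.
  have -> : ((1 + j)%N == l) = false by rewrite /=; lia.
  by rewrite /=; case: ltngtP lti => // ->.
- have l0 : (0 < l)%N by apply: leq_ltn_trans lei.
  have ln : (l.-1 < n)%N by rewrite -ltnS prednK // ltn_ord.
  pose j := Ordinal ln.
  apply: (key (fun x => if j == i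
            then psign marked (v (widen_ord (leqnSn n) j)) x else x)
           j (contract_seq marked i v)).
    by case: (j == i) => ? ? ? /=; rewrite ?psR.
  move=> x; apply/ffunP => k; rewrite !ffunE -!val_eqE /= /bump /=.
  case: (eqVneq (k : nat) l.-1) => [kl|kl]; last first.
    case: (ltngtP k i) => [ki|ki|ki]; do 2?case: eqP => // ?; lia.
  have -> : k = j by apply: val_inj.
  have -> : (l.-1 == l :> nat) = false by lia.
  have -> : ((1 + j)%N == l) = true by rewrite /=; lia.
  by have -> : (l.-1 < i)%N = false by lia.
Qed.

Definition contract n (marked : bool) (i : 'I_n) : tpow A n.+1 -> tpow A n :=
  tlift (contract_multilinear marked i).
HB.instance Definition _ n (marked : bool) (i : 'I_n) :=
  GRing.Linear.on (contract marked i).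

(* The component at [k : 'I_n] is the copy of $A^{\otimes n}$ in which the
   first [k] tensor signs are marked (so [k] is one less than the usual
   1-based number of the copy).  [Tarrow 0] is the zero space, so that the
   differential below vanishes on [Tarrow 1]. *)
Definition Tarrow (n : nat) := {ffun 'I_n -> tpow A n}.
HB.instance Definition _ n := GRing.Lmodule.on (Tarrow n).

Definition copy n (k : 'I_n) (t : tpow A n) : Tarrow n :=
  [ffun l => if l == k then t else 0].

Fact marks_subproof n (k : 'I_n.+1) (i : 'I_n) : (k - (i < k) < n)%N.
Proof.
have := ltn_ord k; have := ltn_ord i; case: (ltnP i k) => ik; lia.
Qed.

(* Number of marked signs left after contracting sign [i], which was marked
   if and only if [i < k]. *)
Definition marks n (k : 'I_n.+1) (i : 'I_n) : 'I_n :=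
  Ordinal (marks_subproof k i).

Definition darrow n (x : Tarrow n.+1) : Tarrow n :=
  \sum_(k < n.+1) \sum_(i < n)
    (-1) ^+ i *: copy (marks k i) (contract (i < k)%N i (x k)).

Fact copy_linear n (k : 'I_n) : linear (@copy n k).
Proof.
move=> c s t; apply/ffunP => l; rewrite !ffunE.
by case: eqP; rewrite ?scaler0 ?addr0.
Qed.

HB.instance Definition _ n (k : 'I_n) :=
  GRing.isLinear.Build K (tpow A n) (Tarrow n) *:%R (@copy n k)
    (@copy_linear n k).

Fact darrow_linear n : linear (@darrow n).
Proof.
move=> c x y; rewrite /darrow scaler_sumr -big_split; apply: eq_bigr => k _ /=.
rewrite scaler_sumr -big_split; apply: eq_bigr => i _ /=.
by rewrite !ffunE !linearP.
Qed.

HB.instance Definition _ n :=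
  GRing.isLinear.Build K (Tarrow n.+1) (Tarrow n) *:%R (@darrow n)
    (@darrow_linear n).

Lemma darrow_copy_tens n (k : 'I_n.+1) (v : {ffun 'I_n.+1 -> A}) :
  darrow (copy k (tens v)) =
  \sum_(i < n) (-1) ^+ i *:
    copy (marks k i) (tens (contract_seq (i < k)%N i v)).
Proof.
rewrite /darrow (bigD1 k) //= [X in _ + X]big1 ?addr0 => [|l lk].
  by apply: eq_bigr => i _; rewrite ffunE eqxx /contract tlift_tens.
rewrite big1 // => i _; rewrite ffunE (negbTE lk).
by rewrite !linear0.
Qed.

Lemma tpow_ind n (M : lmodType K) (f g : {linear tpow A n -> M}) :
  (forall v, f (tens v) = g (tens v)) -> f =1 g.
Proof.
move=> fg t; rewrite -(lquot_reprK t) -(freeg_sumE (lquot_repr t)).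
rewrite !linear_sum; apply: eq_bigr => v _.
have -> : << coeff v (lquot_repr t) *g v >> =
    coeff v (lquot_repr t) *: << v >> :> {freeg _ / K}.
  by apply/eqP/freeg_eqP => w; rewrite coeffZ !coeffU mul1r.
by rewrite !linearZ_LR -/(tens v) fg.
Qed.

Lemma Tarrow_sum n (x : Tarrow n) : x = \sum_k copy k (x k).
Proof.
apply/ffunP => l; rewrite sum_ffunE (bigD1 l) //= ffunE eqxx.
by rewrite big1 ?addr0 // => k kl; rewrite ffunE eq_sym (negbTE kl).
Qed.

Lemma psignA (s t : bool) (a b c : A) : t ==> s ->
  psign t (psign s a b) c = psign s a (psign t b c).
Proof.
by case: s t => -[] //= _; rewrite /psign ?parrA ?parr_mulA ?pmulA.
Qed.

Lemma contract_seq_comm n (k : 'I_n.+2) (i : 'I_n.+1) (j : 'I_n)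
    (v : {ffun 'I_n.+2 -> A}) : (j < i)%N ->
  contract_seq (j < marks k i)%N j (contract_seq (i < k)%N i v) =
  contract_seq (marks i j < marks k (fintype.lift i j))%N (marks i j)
    (contract_seq (fintype.lift i j < k)%N (fintype.lift i j) v).
Proof.
move=> ji; have ik := ltn_ord k; have Hi := ltn_ord i; have Hj := ltn_ord j.
have nth (w : {ffun 'I_n.+2 -> A}) (a b : 'I_n.+2) : a = b :> nat -> w a = w b.
  by move=> /val_inj ->.
apply/ffunP => l; rewrite !ffunE -!val_eqE /= /bump /=.
have -> : (i <= j)%N = false by lia.
rewrite !add0n ji !add1n subn1.
have -> : (i.-1 < k - (j < k))%N = (i < k)%N by lia.
have -> : (j < k - (i < k))%N = (j < k)%N by lia.
rewrite (nth v (fintype.lift ord0 (widen_ord (leqnSn n) l))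
               (widen_ord (leqnSn n.+1) (fintype.lift ord0 l))) //.
move: (v _) (v _) (v _) => a b c.
have ski : (i < k)%N ==> (j < k)%N by lia.
case: (ltngtP l j) => lj; case: (ltngtP l i) => li //=;
  case: (ltngtP l i.-1) => li1 //=; case: (ltngtP l.+1 i) => li2 //=;
  case: (ltngtP l.+1 j) => lj1 //=; try lia.
by rewrite psignA.
Qed.

Lemma darrow_darrow n (x : Tarrow n.+2) : darrow (darrow x) = 0.
Proof.
suff key (k : 'I_n.+2) t : darrow (darrow (copy k t)) = 0.
  rewrite (Tarrow_sum x) (linear_sum (@darrow n.+1)) (linear_sum (@darrow n)).
  by rewrite big1 // => k _; exact: key.
pose f : {linear tpow A n.+2 -> Tarrow n} :=
  @darrow n \o @darrow n.+1 \o copy k.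
apply: (@tpow_ind _ _ f \0 _ t) => v /=.
rewrite darrow_copy_tens (linear_sum (@darrow n)).
pose F (i : 'I_n.+1) (j : 'I_n) : Tarrow n :=
  (-1) ^+ i *: ((-1) ^+ j *: copy (marks (marks k i) j)
    (tens (contract_seq (j < marks k i)%N j (contract_seq (i < k)%N i v)))).
rewrite (eq_bigr (fun i => \sum_j F i j)) => [|i _]; last first.
  by rewrite linearZ_LR -scaler_sumr -darrow_copy_tens.
rewrite pair_big /= (bigID (fun p : 'I_n.+1 * 'I_n => (p.2 < p.1)%N)) /=.
pose phi (p : 'I_n.+1 * 'I_n) := (fintype.lift p.1 p.2, marks p.1 p.2).
have phiK : involutive phi.
  by move=> [i j]; congr pair; apply/val_inj; rewrite /= /bump; lia.
rewrite [X in _ + X](reindex_inj (inv_inj phiK)) /=.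
rewrite -[RHS](subrr (\sum_(p : 'I_n.+1 * 'I_n | (p.2 < p.1)%N) F p.1 p.2)).
congr (_ + _); rewrite -sumrN; apply: eq_big => [[i j]|[i j]] /=.
  by rewrite /bump; lia.
move=> Hji; have ji : (j < i)%N by move: Hji; rewrite /bump /=; lia.
rewrite /F /= -contract_seq_comm // !scalerA -scaleNr; congr (_ *: copy _ _).
  have -> : bump i j = j by rewrite /bump; lia.
  have -> : (-1) ^+ i = - (-1) ^+ (marks i j) :> K.
    by rewrite -[RHS]mulN1r -exprS; congr (_ ^+ _); rewrite /=; lia.
  by rewrite mulNr opprK mulrC.
by apply/val_inj; rewrite /= /bump; lia.
Qed.

Definition cycle_pred n : {pred Tarrow n.+1} := fun x => darrow x == 0.

Fact cycle_submod n : submod_closed (@cycle_pred n).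
Proof.
split=> [|c x y /eqP dx /eqP dy]; apply/eqP.
  by rewrite (linear0 (@darrow n)).
by rewrite darrow_linear dx dy scaler0 addr0.
Qed.

HB.instance Definition _ n := GRing.isSubmodClosed.Build K (Tarrow n.+1)
  (@cycle_pred n) (@cycle_submod n).

Record cycle n := Cycle {
  cycle_val : Tarrow n.+1;
  _ : cycle_val \in @cycle_pred n
}.
HB.instance Definition _ n := [isSub for @cycle_val n].
HB.instance Definition _ n := [Choice of cycle n by <:].
HB.instance Definition _ n := [SubChoice_isSubLmodule of cycle n by <:].

(* By [darrow_darrow] every [darrow y] is a cycle, so this is the whole image of
   the differential, seen in the space of cycles. *)
Definition boundary_pred n : {pred cycle n} := fun z =>
  `[< exists y : Tarrow n.+2, darrow y = val z >].

Fact boundary_submod n : submod_closed (@boundary_pred n).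
Proof.
split=> [|c u v /asboolP[x dx] /asboolP[y dy]]; apply/asboolP.
  by exists 0; rewrite (linear0 (@darrow n.+1)).
by exists (c *: x + y); rewrite darrow_linear dx dy.
Qed.

HB.instance Definition _ n := GRing.isSubmodClosed.Build K (cycle n)
  (@boundary_pred n) (@boundary_submod n).

Definition homology n := lquot (@boundary_pred n).
HB.instance Definition _ n := GRing.Lmodule.on (homology n).

End Complex.

(* Main.v *)
Require Import Defs.
From HB Require Import structures.
From mathcomp Require Import all_boot all_order all_algebra.
From mathcomp Require Import boolp zify.
From mathcomp.multinomials Require Import freeg.

Set Implicit Arguments.
Unset Strict Implicit.
Unset Printing Implicit Defensive.

Import GRing.Theory.
Local Open Scope ring_scope.

(** The free algebra on generators [x_d] has a basis of planar binary trees
    with nodes labelled by generators: every basis element is uniquely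
    $(l \nearrow x_d)\, r$, where each of $l$ and $r$ is either absent or again a
    basis element ([free_tree_coords]).  Associativity of the two products and
    $a \nearrow (bc) = (a \nearrow b) c$ say that $a \nearrow -$ acts on the
    $l$ side of such an element and $- \cdot b$ on its $r$ side.

    In a word $v_1 \otimes_\nearrow \cdots \otimes_\nearrow v_k \otimes \cdots
    \otimes v_n$ the entry $v_k$, which has only marked signs before it and only
    ordinary signs after it, is thus the meeting point of two bar complexes: one
    for $\nearrow$, ending at the $l$ of $v_k$, and one for the product, starting
    at its $r$.  With $l$ and $r$ allowed to be absent, both are normalized bar
    resolutions of unital associative algebras, which are contractible by the
    usual extra degeneracy.  On words of trees the two contractions combine into
    one operator [homotopy], which cuts $v_k = (l \nearrow x_d)\, r$ in two:
    - if $r$ is present, into $l \nearrow x_d$ and $r$, with a new ordinary sign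
      between them;
    - if $r$ is absent, $v_k$ is the last entry and $l$ is present, into $l$ and
      $x_d$, with a new marked sign between them;
    - otherwise the word is sent to 0.
    Contracting the new sign gives the word back, and contracting any other sign
    commutes with the cut up to sign, so $d h + h d = 1$ on words of length at
    least 2 ([homotopy_formula]), whence the vanishing of homology in positive
    degrees.  On words of length 1, $d h$ kills the generators and fixes the
    other trees ([homotopy_formula0]); as no product of trees is a generator,
    boundaries have no component on generators ([leaf_coord_darrow]), so
    that the classes of the $D$ generators form a basis of the homology in
    degree 0. *)

(** * Decorated trees *)

(** [node l d r] stands for $(l \nearrow x_d)\, r$, an absent factor being
    [None]. *)
Inductive tree (X : Type) : Type :=
  node of option (tree X) & X & option (tree X).

Arguments node {X}.

HB.instance Definition _ (X : Type) := gen_eqMixin (tree X).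
HB.instance Definition _ (X : Type) := gen_choiceMixin (tree X).

Section Trees.
Variable X : Type.
Implicit Types (t u a b : tree X) (o : option (tree X)).

Definition leaf (d : X) : tree X := node None d None.

Fixpoint tmul t u : tree X :=
  let: node l d r := t in node l d (Some (if r is Some c then tmul c u else u)).

Fixpoint tarr u t : tree X :=
  let: node l d r := t in node (Some (if l is Some c then tarr u c else u)) d r.

Definition tsign (marked : bool) := if marked then tarr else tmul.

(** The generated induction principle gives no hypothesis on the subtrees, which
    sit under [option]. *)
Lemma tree_option_ind (P : tree X -> Prop) :
  (forall l d r, (if l is Some c then P c else True) ->
     (if r is Some c then P c else True) -> P (node l d r)) ->
  forall t, P t.
Proof.
by move=> IH; fix rec 1 => -[l d r]; apply: IH; [case: l | case: r].
Qed.

Lemma tmulA : associative tmul.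
Proof.
move=> t u v; elim/tree_option_ind: t => l d [c|] _ //= -> //.
Qed.

Lemma tarrA : associative tarr.
Proof.
move=> u v t; elim/tree_option_ind: t => -[c|] d r //= -> //.
Qed.

Lemma tarr_mulA u t v : tarr u (tmul t v) = tmul (tarr u t) v.
Proof. by case: t. Qed.

Lemma tsign_neq_leaf m t u d : tsign m t u <> leaf d.
Proof. by case: m t u => -[l e r] [l' e' r']. Qed.

(** The cut made by the contracting homotopy at the entry where marked signs end
    and ordinary signs begin; [last] tells whether it is the last entry of the
    word, and the boolean of the result is the mark of the new sign. *)
Definition tsplit (last : bool) t : option (bool * tree X * tree X) :=
  let: node l d r := t in
  if r is Some c then Some (false, node l d None, c)
  else if last then omap (fun c => (true, c, leaf d)) l
  else None.

Lemma tsplit_sign last t m a b : tsplit last t = Some (m, a, b) ->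
  tsign m a b = t.
Proof.
case: t => [l d [c|]] /=; first by case=> <- <- <-.
by case: last l => -[c|] //= [<- <- <-].
Qed.

Lemma tsplit_false t m a b : tsplit false t = Some (m, a, b) -> m = false.
Proof. by case: t => [l d [c|]] //= [<-]. Qed.

(** Multiplication on the right happens inside the second piece of a cut at an
    ordinary sign; a tree that has no such cut becomes the first piece. *)
Lemma tsplit_mul last t u :
  tsplit last (tmul t u) =
  Some (if tsplit false t is Some (m, a, b) then (m, a, tmul b u)
        else (false, t, u)).
Proof. by case: t => [l d [c|]]. Qed.

(** Grafting on the left happens inside the first piece of any cut.  The last
    case is that of [t] a single node at the end of the word, which becomes the
    second piece of a marked cut. *)
Lemma tsplit_arr last u t :
  tsplit last (tarr u t) =
  if tsplit last t is Some (m, a, b) then Some (m, tarr u a, b)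
  else if last then Some (true, u, t) else None.
Proof. by case: t last => [l d [c|]] [] //=; case: l. Qed.

Lemma tsplit_true_None t : tsplit true t = None -> exists d, t = leaf d.
Proof. by case: t => [[c|] d [e|]] //= _; exists d. Qed.

End Trees.

(** * Free modules *)

Section FreeModuleExtension.
Variables (K : fieldType) (X : choiceType) (M : lmodType K).

Lemma freeg_linear_ext (f g : {freeg X / K} -> M) :
  linear f -> linear g -> (forall x, f << x >> = g << x >>) -> f =1 g.
Proof.
move=> lf lg fg u.
pose F : {linear {freeg X / K} -> M} :=
  HB.pack f (GRing.isLinear.Build _ _ _ _ f lf).
pose G : {linear {freeg X / K} -> M} :=
  HB.pack g (GRing.isLinear.Build _ _ _ _ g lg).
rewrite -[f u]/(F u) -[g u]/(G u) -(freeg_sumE u) !linear_sum.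
apply: eq_bigr => x _.
have -> : << coeff x u *g x >> = coeff x u *: << x >> :> {freeg X / K}.
  by apply/eqP/freeg_eqP => y; rewrite coeffZ !coeffU mul1r.
by rewrite !linearZ_LR /= fg.
Qed.

Lemma fgliftU (f : X -> M) x : fglift f << x >> = f x.
Proof. by rewrite liftU scale1r. Qed.

Lemma linear_comp (U V W : lmodType K) (f : V -> W) (g : U -> V) :
  linear f -> linear g -> linear (f \o g).
Proof. by move=> lf lg c u v; rewrite /= lg lf. Qed.

Lemma fglift_linear_fun (f g : X -> M) (c : K) (u : {freeg X / K}) :
  fglift (fun x => c *: f x + g x) u = c *: fglift f u + fglift g u.
Proof.
apply: (freeg_linear_ext (f := fglift _)
  (g := fun u => c *: fglift f u + fglift g u)); first exact: fglift_linear.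
  move=> k v w; rewrite !fglift_linear !scalerDr !scalerA (mulrC c) !addrA.
  by congr (_ + _); rewrite addrAC.
by move=> x; rewrite !fgliftU.
Qed.

End FreeModuleExtension.

Section MagmaAlgebra.
Variables (K : fieldType) (T : choiceType).
Local Notation F := {freeg T / K}.

Definition bilinear_ext (op : T -> T -> T) (u v : F) : F :=
  fglift (fun a => fglift (fun b => << op a b >>) v) u.

Lemma bilinear_ext_linear_l op v : linear ((bilinear_ext op)^~ v).
Proof. exact: fglift_linear. Qed.

Lemma bilinear_ext_linear_r op u : linear (bilinear_ext op u).
Proof.
move=> c v w; rewrite /bilinear_ext -fglift_linear_fun; congr (fglift _ u).
by apply/funext => a; rewrite fglift_linear.
Qed.

Lemma bilinear_extU op a b : bilinear_ext op << a >> << b >> = << op a b >>.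
Proof. by rewrite /bilinear_ext !fgliftU. Qed.

Lemma bilinear_extA op1 op2 op3 op4 :
  (forall a b c, op1 (op2 a b) c = op3 a (op4 b c)) ->
  forall u v w, bilinear_ext op1 (bilinear_ext op2 u v) w = bilinear_ext op3 u (bilinear_ext op4 v w).
Proof.
move=> opA u v w; pose L := bilinear_ext_linear_l; pose R := bilinear_ext_linear_r.
move: u; apply: freeg_linear_ext => [||a].
- exact: (linear_comp (L op1 w) (L op2 v)).
- exact: L.
move: v; apply: freeg_linear_ext => [||b].
- exact: (linear_comp (L op1 w) (R op2 _)).
- exact: (linear_comp (R op3 _) (L op4 w)).
move: w; apply: freeg_linear_ext => [||c].
- exact: R.
- exact: (linear_comp (R op3 _) (R op4 _)).
by rewrite !bilinear_extU opA.
Qed.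

End MagmaAlgebra.

Definition tree_alg (K : fieldType) (X : Type) := {freeg (tree X) / K}.
HB.instance Definition _ K X := GRing.Lmodule.on (tree_alg K X).

HB.instance Definition _ (K : fieldType) (X : Type) :=
  Lmodule_isPArrowAlgebra.Build K (tree_alg K X)
    (@bilinear_ext_linear_l K _ (@tmul X)) (@bilinear_ext_linear_r K _ (@tmul X))
    (@bilinear_ext_linear_l K _ (@tarr X)) (@bilinear_ext_linear_r K _ (@tarr X))
    (bilinear_extA (fun a b c => esym (tarrA a b c)))
    (fun u v w => esym (bilinear_extA (fun a b c => esym (tarr_mulA a b c)) u v w))
    (bilinear_extA (fun a b c => esym (tmulA a b c))).

(** * The free algebra has a basis of trees *)

Section Evaluation.
Variables (K : fieldType) (A : parrowAlgType K) (X : Type) (x : X -> A).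

Fixpoint tree_ev (t : tree X) : A :=
  let: node l d r := t in
  let y := if l is Some c then parr (tree_ev c) (x d) else x d in
  if r is Some c then pmul y (tree_ev c) else y.

Lemma tree_ev_mul t u : tree_ev (tmul t u) = pmul (tree_ev t) (tree_ev u).
Proof.
elim/tree_option_ind: t => l d [c|] _ //= ->.
by rewrite pmulA.
Qed.

Lemma tree_ev_arr u t : tree_ev (tarr u t) = parr (tree_ev u) (tree_ev t).
Proof.
elim/tree_option_ind: t => l d r IHl _ /=.
have -> : parr (tree_ev (if l is Some c then tarr u c else u)) (x d) =
    parr (tree_ev u) (if l is Some c then parr (tree_ev c) (x d) else x d).
  by case: l IHl => [c|//] ->; rewrite parrA.
by case: r => // c; rewrite parr_mulA.
Qed.

Lemma tree_ev_sign m t u :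
  tree_ev (tsign m t u) = psign m (tree_ev t) (tree_ev u).
Proof. by case: m; [exact: tree_ev_arr | exact: tree_ev_mul]. Qed.

Definition tree_alg_ev : tree_alg K X -> A := fglift tree_ev.

Lemma tree_alg_ev_morphism : parrow_morphism tree_alg_ev.
Proof.
have lE : linear tree_alg_ev by exact: fglift_linear.
split=> //.
- move=> u v; move: u; apply: freeg_linear_ext => [||a].
  + exact: (linear_comp lE (pmul_linear_l v)).
  + exact: (linear_comp (pmul_linear_l (tree_alg_ev v)) lE).
  move: v; apply: freeg_linear_ext => [||b].
  + exact: (linear_comp lE (pmul_linear_r (_ : tree_alg K X))).
  + exact: (linear_comp (pmul_linear_r _) lE).
  by rewrite /pmul /= bilinear_extU /tree_alg_ev !fgliftU tree_ev_mul.
- move=> u v; move: u; apply: freeg_linear_ext => [||a].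
  + exact: (linear_comp lE (parr_linear_l v)).
  + exact: (linear_comp (parr_linear_l (tree_alg_ev v)) lE).
  move: v; apply: freeg_linear_ext => [||b].
  + exact: (linear_comp lE (parr_linear_r (_ : tree_alg K X))).
  + exact: (linear_comp (parr_linear_r _) lE).
  by rewrite /parr /= bilinear_extU /tree_alg_ev !fgliftU tree_ev_arr.
Qed.

(** The freely spanned [tree_alg] is an algebra receiving a morphism from the free
    algebra, under which [tree_ev x t] goes to [t]; evaluating back gives an
    endomorphism fixing the generators, hence the identity.  So the trees are a
    basis, with the morphism as coordinates. *)
Lemma free_tree_coords : free_on x ->
  exists c : A -> {freeg (tree X) / K},
    [/\ linear c, forall t, c (tree_ev t) = << t >>
      & forall a, fglift tree_ev (c a) = a].
Proof.
move=> A_free.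
have [c [[c_lin c_mul c_arr] c_x] _] :=
  A_free (tree_alg K X) (fun d => << leaf d >>).
exists c; split=> // [t|].
  elim/tree_option_ind: t => l d r IHl IHr /=.
  have {IHl} Ey : c (if l is Some u then parr (tree_ev u) (x d) else x d) =
      << node l d None >>.
    case: l IHl => [u IH|_]; last exact: c_x.
    by rewrite c_arr IH c_x /parr /= bilinear_extU.
  case: r IHr => [u IH|_ //].
  by rewrite c_mul IH Ey /pmul /= bilinear_extU.
have [E_lin E_mul E_arr] := tree_alg_ev_morphism.
have [f _ f_uniq] := A_free A x.
have fid : id =1 f by apply: f_uniq => //; split.
move=> a; rewrite [RHS]fid; apply: (f_uniq (tree_alg_ev \o c)) => [|d].
  split=> [|u v|u v] /=; first exact: linear_comp.
    by rewrite c_mul E_mul.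
  by rewrite c_arr E_arr.
by rewrite /= c_x /tree_alg_ev fgliftU.
Qed.

End Evaluation.

(** * Contracting and splitting entries of a word *)

(** Words are functions on [nat], read up to the length at hand, so that
    contracting or splitting an entry needs no cast between ordinals. *)
Section Words.
Variables (T : Type) (op : T -> T -> T).
Implicit Types (v : nat -> T) (i j k : nat) (a b : T).

Definition fuse i v : nat -> T := fun j =>
  if (j < i)%N then v j else if j == i then op (v j) (v j.+1) else v j.+1.

Definition splice k a b v : nat -> T := fun j =>
  if (j < k)%N then v j else if j == k then a
  else if j == k.+1 then b else v j.-1.

(* Compares two words entry by entry, splitting on all position tests; entries
   that agree only up to arithmetic on their index are matched by [lia]. *)
Ltac by_positions :=
  apply/funext => j; rewrite /fuse /splice;
  repeat (case: ifPn => ?);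
  first [ by [] | exfalso; lia
        | match goal with
          | |- op (?f _) (?f _) = op (?f _) (?f _) =>
              by congr (op (f _) (f _)); lia
          | |- op (?f _) _ = op (?f _) _ => by congr (op (f _) _); lia
          | |- op _ (?f _) = op _ (?f _) => by congr (op _ (f _)); lia
          | |- ?f _ = ?f _ => by congr (f _); lia
          end | idtac ].

Lemma fuse_splice k a b v : op a b = v k -> fuse k (splice k a b v) = v.
Proof. by move=> ab; by_positions; rewrite ab; congr (v _); lia. Qed.

Lemma fuse_splice_lt i k a b v : (i < k)%N ->
  fuse i (splice k a b v) =
  splice k.-1 (if i == k.-1 then op (v i) a else a) b (fuse i v).
Proof. move=> ik; by_positions. Qed.

Lemma fuse_splice_ge i k a b v : (k <= i)%N ->
  fuse i.+1 (splice k a b v) =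
  splice k a (if i == k then op b (v k.+1) else b) (fuse i v).
Proof. move=> ki; by_positions. Qed.

Lemma splice_fuse k v : splice k (v k) (v k.+1) (fuse k v) = v.
Proof. by_positions. Qed.

Lemma fuse_lt i j v : (j < i)%N -> fuse i v j = v j.
Proof. by rewrite /fuse => ->. Qed.

Lemma fuse_eq i v : fuse i v i = op (v i) (v i.+1).
Proof. by rewrite /fuse ltnn eqxx. Qed.

Lemma fuse_gt i j v : (i < j)%N -> fuse i v j = v j.+1.
Proof. by move=> ij; rewrite /fuse ltnNge ltnW // gtn_eqF. Qed.

End Words.

(** * Words as elements of the complex *)

Section Cells.
Variables (K : fieldType) (A : parrowAlgType K).
Implicit Types (v : nat -> A).

Definition cell n k v : Tarrow A n :=
  [ffun l : 'I_n => if l == k :> nat then tens [ffun i : 'I_n => v i] else 0].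

Lemma cell_copy n (k : 'I_n) v :
  copy k (tens [ffun i : 'I_n => v i]) = cell n k v.
Proof. by []. Qed.

Lemma cell_ext n k v w : (forall j, (j < n)%N -> v j = w j) ->
  cell n k v = cell n k w.
Proof.
move=> vw; rewrite /cell.
have -> // : [ffun i : 'I_n => v i] = [ffun i : 'I_n => w i].
by apply/ffunP => i; rewrite !ffunE vw.
Qed.

Lemma darrowZ n c (z : Tarrow A n.+1) : darrow (c *: z) = c *: darrow z.
Proof. exact: linearZ_LR. Qed.

Lemma darrow_cell n k v : (k <= n)%N ->
  darrow (cell n.+1 k v) =
  \sum_(i < n) (-1) ^+ i *: cell n (k - (i < k)) (fuse (psign (i < k)%N) i v).
Proof.
move=> kn; rewrite -(cell_copy (Ordinal (kn : (k < n.+1)%N))).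
rewrite darrow_copy_tens; apply: eq_bigr => i _.
rewrite -(cell_copy (marks (Ordinal (kn : (k < n.+1)%N)) i)) /=.
congr (_ *: copy _ (tens _)).
by apply/ffunP => j; rewrite !ffunE.
Qed.

Lemma cell_upd_linear n k (v : {ffun 'I_n -> A}) (i : 'I_n)
    (w : A -> nat -> A) (c : K) (a b : A) :
  (forall y, [ffun j : 'I_n => w y j] = upd v i y) ->
  cell n k (w (c *: a + b)) = c *: cell n k (w a) + cell n k (w b).
Proof.
move=> E; apply/ffunP => l; rewrite !ffunE !E tens_multilinear.
by case: eqP; rewrite ?scaler0 ?addr0.
Qed.

End Cells.

(* Otherwise conversion compares distinct cells by unfolding the quotients and
   finite functions they are made of. *)
#[local] Opaque cell tens darrow.

(** * Linear maps are determined by words of trees *)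

Section TreeBasis.
Variables (K : fieldType) (A : parrowAlgType K) (X : Type) (x : X -> A).
Variable coords : A -> {freeg (tree X) / K}.
Hypothesis coords_linear : linear coords.
Hypothesis coords_ev : forall t, coords (tree_ev x t) = << t >>.
Hypothesis ev_coords : forall a, fglift (tree_ev x) (coords a) = a.

Local Notation ev := (tree_ev x).
Local Notation tcell n k tau := (@cell K A n k (fun i => ev (tau i))).

Lemma linear_tree_ext (M : lmodType K) (f g : A -> M) :
  linear f -> linear g -> (forall t, f (ev t) = g (ev t)) -> f =1 g.
Proof.
move=> lf lg fg a; rewrite -(ev_coords a).
have lE := fglift_linear (tree_ev x).
apply: (freeg_linear_ext (linear_comp lf lE) (linear_comp lg lE)) => t /=.
by rewrite fgliftU fg.
Qed.

Lemma upd_id n (v : {ffun 'I_n -> A}) i : upd v i (v i) = v.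
Proof. by apply/ffunP => j; rewrite ffunE; case: eqP => [->|]. Qed.

Lemma upd_same n (v : {ffun 'I_n -> A}) i a : upd v i a i = a.
Proof. by rewrite ffunE eqxx. Qed.

Lemma upd_neq n (v : {ffun 'I_n -> A}) i j a : j != i -> upd v i a j = v j.
Proof. by move=> ji; rewrite ffunE (negbTE ji). Qed.

Lemma upd_inord n (v : {ffun 'I_n.+1 -> A}) i a l : (l <= n)%N ->
  upd v i a (inord l) = if l == i then a else v (inord l).
Proof. by move=> ln; rewrite ffunE -val_eqE /= inordK. Qed.

Lemma multilinear_tree_ext n (M : lmodType K) (f g : {ffun 'I_n -> A} -> M) :
  multilinear f -> multilinear g ->
  (forall tau : 'I_n -> tree X,
     f [ffun i => ev (tau i)] = g [ffun i => ev (tau i)]) ->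
  f =1 g.
Proof.
move=> mf mg fg.
(* The first [m] entries are still arbitrary, the others are trees. *)
suff key m (v : {ffun 'I_n -> A}) :
    (forall i : 'I_n, (m <= i)%N -> exists t, v i = ev t) -> f v = g v.
  by move=> v; apply: (key n) => i; rewrite leqNgt ltn_ord.
elim: m v => [|m IH] v hv.
  have [tau vE] := fin_all_exists (fun i => hv i (leq0n i)).
  suff -> : v = [ffun i => ev (tau i)] by [].
  by apply/ffunP => i; rewrite ffunE.
have [mn|nm] := ltnP m n; last first.
  by apply: IH => i mi; have := leq_trans nm mi; rewrite leqNgt ltn_ord.
rewrite -(upd_id v (Ordinal mn)); move: (v _).
apply: linear_tree_ext => [||t]; [exact: mf | exact: mg |].
apply: IH => i mi; rewrite ffunE; case: eqP => [_|/eqP im]; first by exists t.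
by apply: hv; rewrite ltn_neqAle mi andbT eq_sym.
Qed.

Lemma Tarrow_tree_ext n (M : lmodType K) (f g : Tarrow A n.+1 -> M) :
  linear f -> linear g ->
  (forall k tau, (k <= n)%N -> f (tcell n.+1 k tau) = g (tcell n.+1 k tau)) ->
  f =1 g.
Proof.
move=> lf lg fg z.
pose F : {linear Tarrow A n.+1 -> M} :=
  HB.pack f (GRing.isLinear.Build _ _ _ _ f lf).
pose G : {linear Tarrow A n.+1 -> M} :=
  HB.pack g (GRing.isLinear.Build _ _ _ _ g lg).
rewrite -[f z]/(F z) -[g z]/(G z) (Tarrow_sum z) !linear_sum.
apply: eq_bigr => k _; move: (z k).
apply: (@tpow_ind _ _ _ _ (F \o copy k) (G \o copy k)).
have mcopy (L : {linear Tarrow A n.+1 -> M}) :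
    multilinear (fun v => L (copy k (tens v))).
  by move=> v i c a b; rewrite tens_multilinear !linearP.
apply: multilinear_tree_ext => [||tau]; try exact: mcopy.
have -> : [ffun i => ev (tau i)] =
    [ffun i : 'I_n.+1 => ev ((tau \o inord) (i : nat))] :> {ffun 'I_n.+1 -> A}.
  by apply/ffunP => i; rewrite !ffunE /= inord_val.
exact: (fg k (tau \o inord) (ltn_ord k)).
Qed.

(** * The contracting homotopy *)

Definition split_cell n k (v : {ffun 'I_n.+1 -> A}) (t : tree X) :
    Tarrow A n.+2 :=
  if tsplit (k == n) t is Some (m, a, b)
  then (-1) ^+ k *: cell n.+2 (k + m)
         (splice k (ev a) (ev b) (fun j => v (inord j)))
  else 0.

(** The entry [k] of an arbitrary word is expanded over the tree basis before it is
    cut; the remaining entries need no expansion. *)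
Definition split_word n (k : 'I_n.+1) (v : {ffun 'I_n.+1 -> A}) :
    Tarrow A n.+2 := fglift (split_cell k v) (coords (v k)).

Lemma split_cell_upd n (k : 'I_n.+1) (v : {ffun 'I_n.+1 -> A}) a :
  split_cell k (upd v k a) = split_cell k v.
Proof.
apply/funext => t; rewrite /split_cell.
case: tsplit => [[[m p] q]|]; last by [].
pose w := splice k (ev p) (ev q) (fun j => v (inord j)).
rewrite (@cell_ext _ _ _ _ _ w) // {}/w.
move=> j jn; rewrite /splice; have kn := ltn_ord k.
case: ifPn => [jk|jk]; first by rewrite upd_inord ?ifN //; lia.
case: ifPn => // jk'; case: ifPn => // jk1.
by rewrite upd_inord ?ifN //; lia.
Qed.

Lemma split_cell_linear n (k i : 'I_n.+1) (v : {ffun 'I_n.+1 -> A}) t :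
  i != k -> linear (fun a => split_cell k (upd v i a) t).
Proof.
move=> ik c a b.
rewrite /split_cell.
case: tsplit => [[[m p] q]|]; last by rewrite scaler0 addr0.
(* Inserting an entry at [k] moves the later entries one place to the right. *)
have iN : (i + (k < i) < n.+2)%N by have := ltn_ord i; lia.
pose w y := splice k (ev p) (ev q) (fun j => upd v i y (inord j)).
rewrite (@cell_upd_linear _ _ _ _ [ffun j : 'I_n.+2 => w 0 j] (Ordinal iN) w).
  by rewrite scalerDr !scalerA mulrC.
move=> y; apply/ffunP => j; rewrite !ffunE /w /splice -!val_eqE /=.
move: ik; rewrite -val_eqE /= => ik.
have [jn [ltk lti]] := (ltn_ord j, (ltn_ord k, ltn_ord i)).
case: (ltngtP j k) => jk; last by rewrite jk; case: eqP => //; lia.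
  rewrite !upd_inord; try lia.
  have -> : (j == i + (k < i) :> nat)%N = (j == i :> nat) by lia.
  by case: eqP.
case: (eqVneq (j : nat) k.+1) => jk1; first by case: eqP => //; lia.
rewrite !upd_inord; try lia.
have -> : (j == i + (k < i) :> nat)%N = (j.-1 == i :> nat) by lia.
by case: eqP.
Qed.

Lemma split_word_multilinear n (k : 'I_n.+1) : multilinear (split_word k).
Proof.
move=> v i c a b; rewrite /split_word; have [<-|ik] := eqVneq i k.
  by rewrite !upd_same !split_cell_upd coords_linear fglift_linear.
rewrite !(@upd_neq _ _ i k) 1?eq_sym // -fglift_linear_fun.
by congr (fglift _ _); apply/funext => t; rewrite split_cell_linear.
Qed.

Definition homotopy n (z : Tarrow A n.+1) : Tarrow A n.+2 :=
  \sum_(k < n.+1) tlift (@split_word_multilinear n k) (z k).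

Lemma homotopy_linear n : linear (@homotopy n).
Proof.
move=> c u v; rewrite /homotopy scaler_sumr -big_split; apply: eq_bigr => k _.
by rewrite !ffunE tlift_linear.
Qed.

Lemma homotopy_cell n k tau : (k <= n)%N ->
  homotopy (tcell n.+1 k tau) =
  if tsplit (k == n) (tau k) is Some (m, a, b)
  then (-1) ^+ k *: tcell n.+2 (k + m) (splice k a b tau) else 0.
Proof.
move=> kn; pose k' := Ordinal (kn : (k < n.+1)%N).
rewrite -(cell_copy k') /homotopy (bigD1 k') //=.
rewrite [X in _ + X]big1 ?addr0 => [|l lk]; last first.
  by rewrite ffunE (negbTE lk); exact: (linear0 (tlift _)).
rewrite ffunE eqxx tlift_tens /split_word ffunE coords_ev fgliftU.
rewrite /split_cell /=.
case: tsplit => [[[m a] b]|]; last by [].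
rewrite (@cell_ext _ _ _ _ _ (fun i => ev (splice k a b tau i))) // => j jn.
rewrite /splice; case: ltnP => jk; first by rewrite ffunE inordK //; lia.
by case: eqP => // _; case: eqP => // _; rewrite ffunE inordK //; lia.
Qed.

#[local] Opaque homotopy.
HB.instance Definition _ n := GRing.isLinear.Build K (Tarrow A n.+1)
  (Tarrow A n.+2) *:%R (@homotopy n) (@homotopy_linear n).

Lemma darrow_tcell n k tau : (k <= n)%N ->
  darrow (tcell n.+1 k tau) =
  \sum_(i < n) (-1) ^+ i *:
    tcell n (k - (i < k)) (fuse (@tsign X (i < k)%N) i tau).
Proof.
move=> kn; rewrite darrow_cell; last by [].
apply: eq_bigr => i _.
pose tau' := fuse (@tsign X (i < k)%N) i tau.
rewrite (@cell_ext _ _ _ _ _ (fun j => ev (tau' j))) // => j _.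
rewrite /tau' /fuse; case: ifP => // _; case: ifP => // _.
by rewrite tree_ev_sign.
Qed.

Lemma homotopy_darrow_cell n k tau : (k <= n.+1)%N ->
  homotopy (darrow (tcell n.+2 k tau)) =
  \sum_(i < n.+1) (-1) ^+ i *:
    homotopy (tcell n.+1 (k - (i < k)) (fuse (@tsign X (i < k)%N) i tau)).
Proof.
move=> kn; rewrite darrow_tcell // linear_sum.
by apply: eq_bigr => i _; rewrite linearZ_LR.
Qed.

Lemma signs_cancel (V : lmodType K) (p q r s : nat) (z : V) :
  odd (p + q + r + s) ->
  (-1) ^+ p *: ((-1) ^+ q *: z) + (-1) ^+ r *: ((-1) ^+ s *: z) = 0.
Proof.
move=> o; rewrite !scalerA -scalerDl -!exprD.
rewrite -(signr_odd _ (p + q)) -(signr_odd _ (r + s)).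
move: o; rewrite -addnA oddD; case: (odd (p + q)); case: (odd (r + s)) => // _.
  by rewrite addNr scale0r.
by rewrite addrN scale0r.
Qed.

(** When the entry [k] can be cut, contracting the new sign of the cut word gives
    the word back, and the other terms of $d h$ cancel one by one against those of
    $h d$.  When it cannot, $d h$ vanishes and exactly one contraction makes a cut
    possible: that of the sign after entry [k], or of the sign before it if that
    entry is last. *)
Lemma homotopy_formula_cell n k tau : (k <= n.+1)%N ->
  darrow (homotopy (tcell n.+2 k tau)) + homotopy (darrow (tcell n.+2 k tau)) =
  tcell n.+2 k tau.
Proof.
move=> kn; rewrite homotopy_darrow_cell // homotopy_cell //.
case E: (tsplit (k == n.+1) (tau k)) => [[[m a] b]|].
- have km : (k + m <= n.+2)%N by case: m {E} => /=; lia.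
  rewrite darrowZ darrow_tcell; last exact: km.
  (* Sign [k] of the cut word is the new one; [lift k] numbers the others. *)
  rewrite (bigD1_ord (Ordinal (kn : (k < n.+2)%N))) //= scalerDr.
  have -> : (k < k + m)%N = m by case: m {E km}; lia.
  rewrite addnK fuse_splice; last exact: tsplit_sign E.
  rewrite scalerA -expr2 sqrr_sign scale1r.
  rewrite -addrA scaler_sumr -big_split big1 ?addr0; first by [].
  move=> i _ /=; have iN := ltn_ord i.
  have [ik|ki] := ltnP i k; rewrite /= ?subn1 ?subn0.
    have -> : bump k i = i by rewrite /bump leqNgt ik.
    rewrite (leq_trans ik (leq_addr _ _)) fuse_splice_lt; last by [].
    rewrite homotopy_cell; last by lia.
    have -> : (k.-1 == n) = (k == n.+1) by lia.
    have -> : (k + m - true = k.-1 + m)%N by rewrite /=; lia.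
    case: (eqVneq (i : nat) k.-1) => ik1.
      rewrite ik1 /= fuse_eq.
      have -> : k.-1.+1 = k by lia.
      rewrite tsplit_arr E; apply: signs_cancel; lia.
    rewrite fuse_gt; last by lia.
    have -> : k.-1.+1 = k by lia.
    by rewrite E; apply: signs_cancel; lia.
  (* A sign after entry [k] is contracted, so this entry is not last and the cut
     is at an ordinary sign. *)
  have last_false : (k == n.+1) = false by lia.
  rewrite last_false in E; have m_false := tsplit_false E.
  rewrite m_false in E *; rewrite /bump ki add1n addn0.
  rewrite (ltnNge i.+1 k) (leq_trans ki (leqnSn i)) /= subn0.
  rewrite fuse_splice_ge; last by [].
  rewrite homotopy_cell; last by lia.
  case: (eqVneq (i : nat) k) => ik.
    rewrite ik fuse_eq tsplit_mul E addn0.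
    by apply: signs_cancel; lia.
  rewrite fuse_lt; last by lia.
  have -> : (k == n) = false by lia.
  by rewrite E addn0; apply: signs_cancel; lia.
- rewrite (linear0 (@darrow K A n.+2)) add0r.
  have [kn1|kn1] := eqVneq k n.+1.
    rewrite kn1 eqxx in E *; have [d tau_d] := tsplit_true_None E.
    rewrite (bigD1 ord_max) //= ltnSn subSS subn0 homotopy_cell // eqxx.
    rewrite fuse_eq tsplit_arr E addn1 splice_fuse.
    rewrite scalerA -expr2 sqrr_sign scale1r.
    rewrite big1 ?addr0; first by [].
    move=> i ni; have {ni} iN : (i < n)%N.
      by have := ltn_ord i; move: ni; rewrite -val_eqE /=; lia.
    rewrite ltnS (ltnW iN) subSS subn0 homotopy_cell //.
    by rewrite eqxx fuse_gt // E scaler0.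
  have last_false : (k == n.+1) = false by lia.
  rewrite last_false in E; have {kn kn1} kn : (k < n.+1)%N by lia.
  rewrite (bigD1 (Ordinal kn)) //= ltnn subn0 homotopy_cell //.
  rewrite fuse_eq tsplit_mul E addn0 splice_fuse.
  rewrite scalerA -expr2 sqrr_sign scale1r.
  rewrite big1 ?addr0; first by [].
  move=> i ni; have iN := ltn_ord i; move: ni; rewrite -val_eqE /= => ni.
  have [ik|ki] := ltnP i k.
    rewrite /= subn1 homotopy_cell; last by lia.
    have -> : (k.-1 == n) = false by lia.
    case: (eqVneq (i : nat) k.-1) => ik1.
      rewrite ik1 fuse_eq.
      have -> : k.-1.+1 = k by lia.
      by rewrite tsplit_arr E scaler0.
    rewrite fuse_gt; last by lia.
    have -> : k.-1.+1 = k by lia.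
    by rewrite E scaler0.
  rewrite subn0 homotopy_cell; last by lia.
  rewrite fuse_lt; last by lia.
  have -> : (k == n) = false by lia.
  by rewrite E scaler0.
Qed.

Lemma homotopy_formula n (z : Tarrow A n.+2) :
  darrow (homotopy z) + homotopy (darrow z) = z.
Proof.
apply: (Tarrow_tree_ext (g := id)
  (f := fun z => darrow (homotopy z) + homotopy (darrow z))) => //.
  by move=> c u v; rewrite homotopy_linear !darrow_linear homotopy_linear
    scalerDr addrACA.
move=> k tau kn; exact: homotopy_formula_cell.
Qed.

(** * Degree zero *)

Lemma darrow_homotopy_cell0 tau :
  darrow (homotopy (tcell 1 0 tau)) =
  if tsplit true (tau 0%N) is Some _ then tcell 1 0 tau else 0.
Proof.
rewrite homotopy_cell; last by [].
rewrite /=; case E: (tsplit _ _) => [[[m a] b]|]; last first.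
  exact: (linear0 (@darrow K A 1)).
rewrite scale1r darrow_tcell; last by case: (m).
have -> : (0 + m = m)%N by [].
rewrite big_ord1 scale1r.
have -> : (m - (0 < m) = 0)%N by case: (m).
have -> : (0 < m)%N = m by case: (m).
by rewrite fuse_splice //; exact: tsplit_sign E.
Qed.

Definition leaf_coord_entry (d : X) (v : {ffun 'I_1 -> A}) : K^o :=
  coeff (leaf d) (coords (v ord0)).

Lemma leaf_coord_multilinear d : multilinear (leaf_coord_entry d).
Proof.
move=> v i c a b; rewrite /leaf_coord_entry (ord1 i) !upd_same coords_linear.
exact: (fglift_linear (fun t => (t == leaf d)%:R : K^o)).
Qed.

Definition leaf_coord d (z : Tarrow A 1) : K^o :=
  tlift (leaf_coord_multilinear d) (z ord0).

Lemma leaf_coord_linear d : linear (leaf_coord d).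
Proof. by move=> c u v; rewrite /leaf_coord !ffunE; exact: tlift_linear. Qed.

HB.instance Definition _ d := GRing.isLinear.Build K (Tarrow A 1) K^o *:%R
  (leaf_coord d) (leaf_coord_linear d).

Lemma leaf_coord_cell d tau :
  leaf_coord d (tcell 1 0 tau) = (tau 0%N == leaf d)%:R.
Proof.
rewrite /leaf_coord -(cell_copy ord0) ffunE eqxx tlift_tens.
rewrite /leaf_coord_entry ffunE /=.
by rewrite coords_ev coeffU mul1r.
Qed.

Lemma leaf_coord_darrow d (z : Tarrow A 2) : leaf_coord d (darrow z) = 0.
Proof.
move: z; apply: (Tarrow_tree_ext (g := fun=> 0)
  (f := fun z => leaf_coord d (darrow z))).
- exact: (linear_comp (leaf_coord_linear d) (@darrow_linear K A 1)).
- by move=> c u v; rewrite scaler0 addr0.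
move=> k tau k1; rewrite darrow_tcell; last by [].
rewrite big_ord1 scale1r.
have -> : (k - (0 < k) = 0)%N by lia.
rewrite leaf_coord_cell fuse_eq.
by case: eqP => // h; case: (tsign_neq_leaf h).
Qed.

End TreeBasis.

Section Generators.
Variables (K : fieldType) (A : parrowAlgType K) (D : nat) (x : 'I_D -> A).
Variable coords : A -> {freeg (tree 'I_D) / K}.
Hypothesis coords_linear : linear coords.
Hypothesis coords_ev : forall t, coords (tree_ev x t) = << t >>.
Hypothesis ev_coords : forall a, fglift (tree_ev x) (coords a) = a.

Local Notation ev := (tree_ev x).
Local Notation tcell n k tau := (@cell K A n k (fun i => ev (tau i))).
Local Notation homotopy := (homotopy x coords_linear).
Local Notation leaf_coord := (leaf_coord coords_linear).

Definition gen_cell (d : 'I_D) : Tarrow A 1 := tcell 1 0 (fun=> leaf d).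

Lemma leaf_coord_gen_cell d e : leaf_coord d (gen_cell e) = (e == d)%:R.
Proof.
rewrite leaf_coord_cell; last exact: coords_ev.
by congr (nat_of_bool _)%:R; apply/eqP/eqP => [[]|->].
Qed.

Lemma leaf_coord_sum d (c : 'I_D -> K) :
  leaf_coord d (\sum_e c e *: gen_cell e) = c d.
Proof.
rewrite (linear_sum (leaf_coord d)).
have E e : leaf_coord d (c e *: gen_cell e) = c e * (e == d)%:R.
  by rewrite (linearZ_LR (leaf_coord d)) /= leaf_coord_gen_cell.
rewrite (bigD1 d) //= big1 ?addr0 => [|e ed]; first by rewrite E eqxx mulr1.
by rewrite E (negbTE ed) mulr0.
Qed.

Lemma homotopy_formula0 (z : Tarrow A 1) :
  darrow (homotopy z) + \sum_d (leaf_coord d z : K) *: gen_cell d = z.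
Proof.
apply: (Tarrow_tree_ext ev_coords (g := id)
  (f := fun z => darrow (homotopy z) +
     \sum_d (leaf_coord d z : K) *: gen_cell d)).
- move=> c u v; rewrite homotopy_linear darrow_linear scalerDr addrACA.
  congr (_ + _); rewrite scaler_sumr -big_split; apply: eq_bigr => d _ /=.
  by rewrite leaf_coord_linear scalerDl scalerA.
- by [].
case=> // tau _; rewrite darrow_homotopy_cell0; last exact: coords_ev.
case E: (tsplit true (tau 0%N)) => [[[m a] b]|].
  rewrite big1 ?addr0; first by [].
  move=> d _; rewrite leaf_coord_cell; last exact: coords_ev.
  by case: eqP E => [-> //|_ _]; rewrite scale0r.
have [e tau_e] := tsplit_true_None E.
have -> : tcell 1 0 tau = gen_cell e.
  by apply: cell_ext => -[|//] _; rewrite tau_e.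
rewrite add0r (bigD1 e) //= leaf_coord_gen_cell eqxx scale1r.
rewrite big1 ?addr0; first by [].
by move=> d de; rewrite leaf_coord_gen_cell eq_sym (negbTE de) scale0r.
Qed.

End Generators.

Theorem theorem10 (K : fieldType) (D : nat) (A : parrowAlgType K)
    (x : 'I_D -> A) (D_ge1 : (1 <= D)%N) (A_free : free_on x) :
  has_dim (homology A 0) D /\
  (forall n : nat, (1 <= n)%N -> forall h : homology A n, h = 0).
Proof.
have [coords [c_lin c_ev ev_c]] := free_tree_coords A_free.
split=> [|[//|n] _ h].
  have cycle0 (z : Tarrow A 1) : z \in @cycle_pred K A 0.
    by apply/eqP/ffunP => -[].
  pose gen d := Cycle (cycle0 (gen_cell x d)).
  exists (fun d => lquot_pi (@boundary_pred K A 0) (gen d)) => h.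
  rewrite -(lquot_reprK h); set z := lquot_repr h.
  have piE (c : {ffun 'I_D -> K}) :
      (lquot_pi (@boundary_pred K A 0) z =
         \sum_d c d *: lquot_pi (@boundary_pred K A 0) (gen d)) <->
      exists y : Tarrow A 2, darrow y = val z - \sum_d c d *: gen_cell x d.
    have -> : \sum_d c d *: lquot_pi (@boundary_pred K A 0) (gen d) =
        lquot_pi (@boundary_pred K A 0) (\sum_d c d *: gen d).
      by rewrite linear_sum; apply: eq_bigr => d _; rewrite linearZ_LR.
    have <- : val (z - \sum_d c d *: gen d) =
        val z - \sum_d c d *: gen_cell x d.
      by rewrite linearB linear_sum.
    by split=> [/lquot_eqP/asboolP|?]; last by apply/lquot_eqP/asboolP.
  exists [ffun d => leaf_coord c_lin d (val z)]; split.
    apply/piE; exists (homotopy x c_lin (val z)).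
    rewrite -{2}(homotopy_formula0 c_lin c_ev ev_c (val z)).
    rewrite [X in _ - X](eq_bigr _ (fun d _ => congr1 ( *:%R^~ _) (ffunE _ d))).
    by rewrite addrK.
  move=> c /piE[y yE]; apply/ffunP => d; rewrite ffunE.
  have zE : val z = 1 *: darrow y + \sum_e c e *: gen_cell x e.
    by rewrite scale1r yE subrK.
  rewrite zE leaf_coord_linear (leaf_coord_darrow c_lin c_ev ev_c).
  rewrite scaler0 add0r.
  exact: leaf_coord_sum.
rewrite -(lquot_reprK h) -(linear0 (lquot_pi (@boundary_pred K A n.+1))).
apply/lquot_eqP; rewrite subr0; apply/asboolP.
exists (homotopy x c_lin (val (lquot_repr h))).
have dz : darrow (val (lquot_repr h)) = 0.
  by apply/eqP; exact: (valP (lquot_repr h)).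
rewrite -{2}(homotopy_formula c_lin c_ev ev_c (val (lquot_repr h))) dz.
by rewrite (linear0 (@homotopy _ _ _ x _ c_lin n)) addr0.
Qed.
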